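(* Let $M\subset\mathbb{M}^n(C)$ be a connected hypersurface with unit normal vector field $N$. Then there exists a concircular vector field $V$ on $\mathbb{M}^n(C)$ which is parallel to the normal vector field along $M$ (i.e. $V|_M=\lambda N$ for some nonzero differentiable function $\lambda$ on $M$) if and only if $M$ is a totally umbilical hypersurface in $\mathbb{M}^n(C)$.
   Context: Let $C\neq 0$ be real, $n\ge 2$, and write $C=\varepsilon/R^2$ with $R>0$, $\varepsilon=(-1)^\nu$, $\nu\in\{0,1\}$. $\mathbb{R}^{n+1}_\nu$ is $\mathbb{R}^{n+1}$ with the flat metric $\langle\,,\rangle=\varepsilon\,dx_1^2+dx_2^2+\cdots+dx_{n+1}^2$. $\mathbb{M}^n(C)=\{p\in\mathbb{R}^{n+1}_\nu:\langle p,p\rangle=1/C\}$ (the sheet $x_1>0$ if $C<0$), with the induced metric, is the sphere or hyperbolic space of constant curvature $C$, with Levi-Civita connection $\overline\nabla$. A vector field $V$ on $\mathbb{M}^n(C)$ is concircular if $\overline\nabla_XV=\mu X$ for all tangent $X$, for some smooth function $\mu$ on $\mathbb{M}^n(C)$. A hypersurface $M$ with unit normal $N$ and shape operator $A$ ($AX=-\overline\nabla_XN$) is totally umbilical if there is a constant $m$ such that $AX=mX$ for all $X$ tangent to $M$; equivalently, $M$ is (an open piece of) the intersection of $\mathbb{M}^n(C)$ with an affine hyperplane of $\mathbb{R}^{n+1}_\nu$. (For $n\ge3$ constancy of $m$ is automatic.) *)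

(* Defs.v *)
From HB Require Import structures.
From mathcomp Require Import all_boot all_order all_algebra.
From mathcomp Require Import all_classical all_reals all_analysis.

Set Implicit Arguments.
Unset Strict Implicit.
Unset Printing Implicit Defensive.

Import Order.TTheory GRing.Theory Num.Theory.
Import numFieldNormedType.Exports.

Local Open Scope classical_set_scope.
Local Open Scope ring_scope.

(* C^k on an open set U; Ck k.+1 asks for (Frechet) differentiability on U and
   for all directional derivatives to be C^k. *)
Fixpoint Ck (R : realType) (V W : normedModType R) (k : nat) (U : set V)
    (F : V -> W) : Prop :=
  match k with
  | 0%N => forall u, U u -> {for u, continuous F}
  | k'.+1 => (forall u, U u -> differentiable F u) /\
             forall v : V, Ck k' U (fun u => 'D_v F u)
  end.

Definition smooth_on (R : realType) (V W : normedModType R) (U : set V)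
    (F : V -> W) : Prop := forall k, Ck k U F.

(* G is smooth near p and extends the restriction of F to S. *)
Definition local_extension (R : realType) (V W : normedModType R) (S : set V)
    (F : V -> W) (p : V) (G : V -> W) : Prop :=
  exists O : set V, [/\ open O, O p, smooth_on O G &
    forall q, O q -> S q -> G q = F q].

(* Smoothness of F|S for an arbitrary subset S of a vector space; the values of
   F outside S are irrelevant. *)
Definition smooth_along (R : realType) (V W : normedModType R) (S : set V)
    (F : V -> W) : Prop :=
  forall p, S p -> exists G, local_extension S F p G.

Section SpaceForm.
Variables (R : realType) (n : nat) (C : R).

Local Notation E := 'rV[R]_n.+1.

(* The sign epsilon of C, i.e. (-1)^nu where nu = 1 iff C < 0. *)
Definition eps : R := (-1) ^+ (C < 0)%R.

(* The flat metric <p, q> of R^{n+1}_nu; coordinates are indexed from 0. *)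
Definition flat (p q : E) : R :=
  eps * (p 0 0 * q 0 0) + \sum_(i < n) p 0 (lift 0 i) * q 0 (lift 0 i).

Definition space_form : set E :=
  [set p | flat p p = C^-1 /\ (C < 0 -> 0 < p 0 0)].

(* The tangent space of the space form at p is the orthogonal of p. *)
Definition tangent (p X : E) : Prop := flat X p = 0.

(* Orthogonal projection on the tangent space at p, for p in the space form
   (where <p, p> = 1/C). *)
Definition tan_proj (p w : E) : E := w - (C * flat w p) *: p.

(* The Levi-Civita connection of the induced metric: Y is the covariant
   derivative at p of the vector field V along the tangent vector X, i.e. the
   tangential part of the flat derivative along X of any smooth local extension
   of V. *)
Definition is_cov_deriv (V : E -> E) (p X Y : E) : Prop :=
  forall G, local_extension space_form V p G -> tan_proj p ('D_X G p) = Y.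

Definition vector_field (V : E -> E) : Prop :=
  smooth_along space_form V /\ forall p, space_form p -> tangent p (V p).

Definition concircular (V : E -> E) : Prop :=
  vector_field V /\
  exists mu : E -> R^o, smooth_along space_form mu /\
    forall p X, space_form p -> tangent p X ->
      is_cov_deriv V p X (mu p *: X).

Section Hypersurface.
Variables (M : topologicalType) (x : M -> E).

(* A local parametrization phi : U -> M of M, compatible with the immersion x:
   a homeomorphism from an open set U of R^{n-1} onto an open subset of M such
   that x o phi is a smooth immersion.  (Any two of these differ by a
   diffeomorphism, so the immersion x determines the smooth structure of M and
   these are all its local parametrizations.) *)
Definition local_param (U : set 'rV[R]_n.-1) (phi : 'rV[R]_n.-1 -> M) : Prop :=
  [/\ open U,
      set_inj U phi /\ (forall u, U u -> {for u, continuous phi}),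
      (forall O, open O -> O `<=` U -> open (phi @` O)),
      smooth_on U (x \o phi) &
      forall u v, U u -> 'D_v (x \o phi) u = 0 -> v = 0].

(* x : M -> R^{n+1}_nu is a hypersurface of the space form.  An embedded
   hypersurface is the case where M is a subset of the space form with the
   subspace topology and x is the inclusion. *)
Definition hypersurface : Prop :=
  [/\ hausdorff_space M, @second_countable M,
      forall s, space_form (x s) &
      forall s, exists U phi, local_param U phi /\ (phi @` U) s].

Definition smooth_on_hypersurface (W : normedModType R) (g : M -> W) : Prop :=
  forall U phi, local_param U phi -> smooth_on U (g \o phi).

(* N is a vector field along x; the tangent vectors of the hypersurface at
   phi u are the 'D_v (x \o phi) u. *)
Definition unit_normal (N : M -> E) : Prop :=
  [/\ smooth_on_hypersurface N,
      forall s, tangent (x s) (N s),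
      forall s, flat (N s) (N s) = 1 &
      forall U phi, local_param U phi -> forall u v, U u ->
        flat (N (phi u)) ('D_v (x \o phi) u) = 0].

(* A X = - nabla_X N at the point phi u, for X = 'D_v (x \o phi) u. *)
Definition shape_op (N : M -> E) (phi : 'rV[R]_n.-1 -> M)
    (u v : 'rV[R]_n.-1) : E :=
  - tan_proj (x (phi u)) ('D_v (N \o phi) u).

Definition totally_umbilical (N : M -> E) : Prop :=
  exists m : R, forall U phi, local_param U phi -> forall u v, U u ->
    shape_op N phi u v = m *: 'D_v (x \o phi) u.

End Hypersurface.
End SpaceForm.

(* Main.v *)
(* A concircular field V is locally the tangential projection of a constant
   vector a of R^{n+1}. Indeed, along the geodesic from p to q the component of V
   on any constant vector orthogonal to p and q has zero derivative, so V p - V q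
   is a combination of p and q; comparing these relations for three linearly
   independent points shows that the coefficient of p does not depend on q, which
   means that V q - b(q) q is a constant vector a, with b(q) = - C <a, q> since
   <V q, q> = 0.  Hence mu(q) = - C <a, q>.
   If V = lambda N along M, then <a, X> = 0 for X tangent to M, so mu is locally
   constant along M; differentiating lambda N = a - C <a, x> x along X shows that
   lambda is locally constant too and that A X = - (mu / lambda) X.
   Conversely, if A X = m X then N + m x is a constant vector a, and N is the
   restriction to M of the tangential projection of a. *)
Require Import Defs.
From HB Require Import structures.
From mathcomp Require Import all_boot all_order all_algebra.
From mathcomp Require Import all_classical all_reals all_analysis.
From mathcomp Require Import ring lra.

Set Implicit Arguments.
Unset Strict Implicit.
Unset Printing Implicit Defensive.

Import Order.TTheory GRing.Theory Num.Theory.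
Import numFieldNormedType.Exports.

Local Open Scope classical_set_scope.
Local Open Scope ring_scope.

(** * Directional derivatives of vector-valued maps *)

Section Calculus.
Variables (R : realType) (V : normedModType R).

Lemma is_derive_mxP (m n : nat) (f : V -> 'M[R]_(m, n)) (u v : V)
    (df : 'M[R]_(m, n)) :
  is_derive u v f df <->
  forall i j, is_derive u v (fun w => f w i j) (df i j).
Proof.
split=> [[fuv <-] i j|fij].
  apply: DeriveDef; first by move/derivable_mxP : fuv.
  by rewrite (derive_mx fuv) mxE.
have fuv : derivable f u v by apply/derivable_mxP => i j; case: (fij i j).
apply: DeriveDef => //; rewrite (derive_mx fuv).
by apply/matrixP => i j; rewrite mxE; case: (fij i j).
Qed.

Lemma is_derive_scale (n : nat) (k : V -> R) (f : V -> 'rV[R]_n) (u v : V)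
    (dk : R) (df : 'rV[R]_n) :
  is_derive u v k dk -> is_derive u v f df ->
  is_derive u v (fun w => k w *: f w) (dk *: f u + k u *: df).
Proof.
move=> hk /is_derive_mxP hf; apply/is_derive_mxP => i j.
rewrite [X in is_derive _ _ X _](_ : _ = k * (fun w => f w i j)); last first.
  by apply/funext => w; rewrite mxE.
apply: (is_derive_eq (is_deriveM hk (hf i j))).
by rewrite !mxE addrC [dk * _]mulrC.
Qed.

End Calculus.

Lemma is_derive_line (R : realType) (n : nat) (p w : 'rV[R]_n) (t : R) :
  is_derive t 1 (fun s : R => p + s *: w) w.
Proof.
apply: (is_derive_eq (is_deriveD (is_derive_cst p t 1)
  (is_derive_scale (is_derive_id t 1) (is_derive_cst w t 1)))).
by rewrite add0r scaler0 addr0 scale1r.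
Qed.

(** * Product rule for the flat metric and chain rule along curves *)

Section FlatDerivative.
Variables (R : realType) (V : normedModType R).

Lemma is_derive_flat (n : nat) (C : R) (f g : V -> 'rV[R]_n.+1) (u v : V)
    (df dg : 'rV[R]_n.+1) :
  is_derive u v f df -> is_derive u v g dg ->
  is_derive u v (fun w => flat C (f w) (g w))
    (flat C df (g u) + flat C (f u) dg).
Proof.
move=> /is_derive_mxP hf /is_derive_mxP hg.
have hM i := is_deriveM (hf 0 i) (hg 0 i).
rewrite /flat.
have := is_deriveD (is_deriveZ (eps C) (hM 0)) (is_derive_sum (fun i => hM (lift 0 i))).
set F := (X in is_derive _ _ X _) => H.
rewrite [X in is_derive _ _ X _](_ : _ = F); last first.
  by apply/funext => w; rewrite /F fctE [LHS]/=; congr +%R; rewrite fct_sumE.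
apply: (is_derive_eq H).
rewrite addrACA -mulrDr -big_split; congr (_ + _).
  by rewrite addrC /GRing.scale/=; congr (_ * (_ + _)); rewrite mulrC.
by apply: eq_bigr => i _; rewrite addrC /GRing.scale/=; congr (_ + _); rewrite mulrC.
Qed.

Lemma differentiable_is_derive (W : normedModType R) (f : V -> W) (u v : V) :
  differentiable f u -> is_derive u v f ('D_v f u).
Proof. by move=> /diff_derivable fu; exact: derivableP. Qed.

Lemma is_derive_comp_curve (W : normedModType R) (G : V -> W) (g : R -> V)
    (t : R) (dg : V) :
  differentiable G (g t) -> is_derive t 1 g dg ->
  is_derive t 1 (G \o g) ('D_dg G (g t)).
Proof.
move=> dG [/derivable1_diffP gt <-].
have dGg : differentiable (G \o g) t by exact: differentiable_comp.
apply: DeriveDef; first exact/derivable1_diffP.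
by rewrite !deriveE// diff_comp.
Qed.

End FlatDerivative.

(** * Bilinearity, continuity and nondegeneracy of the flat metric *)

Section FlatMetric.
Variables (R : realType) (n : nat) (C : R).

Local Notation E := 'rV[R]_n.+1.
Local Notation flat := (@flat R n C).
Implicit Types (p q X Y : E) (a b : R).

Lemma flatC p q : flat p q = flat q p.
Proof.
rewrite /flat [p 0 0 * _]mulrC; congr (_ + _).
by apply: eq_bigr => i _; rewrite mulrC.
Qed.

Lemma flatDl p q Y : flat (p + q) Y = flat p Y + flat q Y.
Proof.
rewrite /flat addrACA -mulrDr -big_split mxE mulrDl; congr (_ + _).
by apply: eq_bigr => i _; rewrite mxE mulrDl.
Qed.

Lemma flatZl a p Y : flat (a *: p) Y = a * flat p Y.
Proof.
rewrite /flat mulrDr mulr_sumr mxE; congr (_ + _); first by ring.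
by apply: eq_bigr => i _; rewrite mxE mulrA.
Qed.

Lemma flatNl p Y : flat (- p) Y = - flat p Y.
Proof. by rewrite -scaleN1r flatZl mulN1r. Qed.

Lemma flatDr p q Y : flat Y (p + q) = flat Y p + flat Y q.
Proof. by rewrite flatC flatDl !(flatC _ Y). Qed.

Lemma flatZr a p Y : flat Y (a *: p) = a * flat Y p.
Proof. by rewrite flatC flatZl flatC. Qed.

Lemma flatNr p Y : flat Y (- p) = - flat Y p.
Proof. by rewrite flatC flatNl flatC. Qed.

Lemma flat0l Y : flat 0 Y = 0.
Proof. by rewrite -(scale0r 0) flatZl mul0r. Qed.

Lemma flat0r Y : flat Y 0 = 0.
Proof. by rewrite flatC flat0l. Qed.

Definition flatE := (flatDl, flatDr, flatNl, flatNr, flatZl, flatZr, flat0l, flat0r).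

Lemma cvg_flat (T : Type) (F : set_system T) (FF : Filter F) (f g : T -> E) p q :
  f x @[x --> F] --> p -> g x @[x --> F] --> q ->
  flat (f x) (g x) @[x --> F] --> flat p q.
Proof.
move=> fp gq.
have coordM i : f x 0 i * g x 0 i @[x --> F] --> p 0 i * q 0 i.
  apply: cvgM; first exact: (cvg_comp _ _ fp (@coord_continuous _ _ _ 0 i _)).
  exact: (cvg_comp _ _ gq (@coord_continuous _ _ _ 0 i _)).
apply: cvgD; first by apply: cvgM; [exact: cvg_cst|exact: coordM].
by apply: cvg_big => [|i _]; [exact: add_continuous|exact: coordM].
Qed.

(** Nondegeneracy: since [eps] squares to 1, multiplying coordinate 0 of the functional by [eps]
    cancels the sign in the metric. *)
Lemma flat_representation (c : 'cV[R]_n.+1) :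
  exists Y, forall p, flat p Y = (p *m c) 0 0.
Proof.
exists (\row_j (if j == 0 then eps C * c j 0 else c j 0)) => p.
rewrite /flat !mxE big_ord_recl eqxx mulrCA; congr (_ + _).
  by rewrite (mulrA (eps C)) /eps -expr2 sqrr_sign mul1r.
by apply: eq_bigr => i _; rewrite mxE eq_sym (negPf (neq_lift _ _)).
Qed.

(** Each column of the cokernel of the matrix with rows [p] and [q] is represented by some [Y]
    orthogonal to both. Hence [d] is killed by the cokernel, which puts it in the row space. *)
Lemma flat_biorthogonal d p q :
  (forall Y, flat p Y = 0 -> flat q Y = 0 -> flat d Y = 0) ->
  exists a b, d = a *: p + b *: q.
Proof.
move=> dY.
have : (d <= col_mx p q)%MS.
  rewrite submxE; apply/eqP/rowP => j.
  have [Y YE] := flat_representation (col j (cokermx (col_mx p q))).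
  have ker : col_mx (p *m cokermx (col_mx p q)) (q *m cokermx (col_mx p q)) = 0.
    by rewrite -mul_col_mx mulmx_coker.
  have coordE r : (r *m cokermx (col_mx p q)) 0 j = flat r Y.
    by rewrite YE [LHS]mxE [RHS]mxE; apply: eq_bigr => k _; rewrite [col _ _ _ _]mxE.
  rewrite coordE [RHS]mxE; apply: dY; rewrite -coordE.
    by rewrite -(col_mxEu _ (q *m cokermx (col_mx p q))) ker mxE.
  by rewrite -(col_mxEd (p *m cokermx (col_mx p q))) ker mxE.
case/submxP => D ->.
exists (lsubmx D 0 0), (rsubmx D 0 0).
rewrite -[D in LHS]hsubmxK mul_row_col; congr (_ + _).
  by rewrite [lsubmx D in LHS]mx11_scalar mul_scalar_mx.
by rewrite [rsubmx D in LHS]mx11_scalar mul_scalar_mx.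
Qed.

(** Differentiating the constant [flat (f w) (f w)] gives twice the claimed product. This yields
    tangency of velocities on the space form and orthogonality of a unit field to its derivative. *)
Lemma is_derive_flat_const (V : normedModType R) (f : V -> E) (u v : V) df k :
  (\near u, flat (f u) (f u) = k) -> is_derive u v f df -> flat df (f u) = 0.
Proof.
move=> fk hf.
have [_ H] := is_derive_flat C hf hf.
move: H; rewrite (near_eq_derive (g := cst k))// derive_cst [flat (f u) df]flatC.
by move=> H; lra.
Qed.

End FlatMetric.

(** * Radial projection onto the space form *)

Section Normalization.
Variables (R : realType) (n : nat) (C : R).
Hypothesis C0 : C != 0.

Local Notation E := 'rV[R]_n.+1.
Local Notation flat := (@flat R n C).

(** The factor [C] makes the radicand positive on the cone for either sign of [C], and equal to 1 on
    the space form. *)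
Definition normalize (c : E) : E := (Num.sqrt (C * flat c c))^-1 *: c.

(* The open cone of the positive multiples of points of the space form. *)
Definition space_form_cone : set E :=
  [set c | 0 < C * flat c c /\ (C < 0 -> 0 < c 0 0)].

Lemma flat_space_form p : space_form C p -> flat p p = C^-1.
Proof. by case. Qed.

Lemma space_form_subcone p : space_form C p -> space_form_cone p.
Proof. by case=> pp p0; split=> //; rewrite pp divff. Qed.

Lemma normalize_space_form p : space_form C p -> normalize p = p.
Proof. by case=> pp _; rewrite /normalize pp divff// sqrtr1 invr1 scale1r. Qed.

Lemma space_form_normalize c : space_form_cone c -> space_form C (normalize c).
Proof.
case=> cc c0; split=> [|/c0 c0']; last by rewrite mxE mulr_gt0// invr_gt0 sqrtr_gt0.
rewrite !flatE mulrA -invfM -expr2 sqr_sqrtr ?ltW//.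
by rewrite invfM mulfVK//; apply: contraTneq cc => ->; rewrite mulr0 ltxx.
Qed.

Lemma near_space_form_cone (V : normedModType R) (c : V -> E) (u : V) :
  differentiable c u -> space_form_cone (c u) ->
  \forall w \near u, space_form_cone (c w).
Proof.
move=> dc [cc c0].
have cc_cvg : c w @[w --> u] --> c u by exact: differentiable_continuous.
have cont_c0 : c w 0 0 @[w --> u] --> c u 0 0.
  exact: (cvg_comp _ _ cc_cvg (@coord_continuous _ _ _ 0 0 _)).
have cont_cc : C * flat (c w) (c w) @[w --> u] --> C * flat (c u) (c u).
  by apply: cvgM; [exact: cvg_cst|exact: cvg_flat].
have near_c0 : \forall w \near u, C < 0 -> 0 < c w 0 0.
  have [/c0 c0'|C0'] := ltP C 0; last by near=> w.
  by near=> w => _; near: w; exact: (cvgr_gt _ cont_c0 _ c0').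
near=> w; split; near: w => //.
exact: (cvgr_gt _ cont_cc _ cc).
Unshelve. all: by end_near. Qed.

(** The derivative of the scalar factor enters only through the unspecified coefficient [a].
    Tangency holds because the projected curve stays in the space form, where [flat p p] is
    constant. *)
Lemma normalize_curve (c : R -> E) (t : R) (w : E) :
  is_derive t 1 c w -> space_form_cone (c t) ->
  exists a, let X := a *: c t + (Num.sqrt (C * flat (c t) (c t)))^-1 *: w in
    [/\ is_derive t 1 (normalize \o c) X, tangent C (normalize (c t)) X &
      \forall s \near t, space_form C (normalize (c s))].
Proof.
move=> hc ct; have [cc _] := ct.
have dc : differentiable c t by apply/derivable1_diffP; case: hc.
have near_sf : \forall s \near t, space_form C (normalize (c s)).
  by apply: filterS (near_space_form_cone dc ct) => s; exact: space_form_normalize.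
have dq : is_derive t 1 (C \*: (fun s => flat (c s) (c s))) (C * (flat w (c t) + flat (c t) w)).
  exact: is_deriveZ (is_derive_flat C hc hc).
have ds := @is_derive1_comp _ _ (fun s => C * flat (c s) (c s)) t _ _ (is_derive1_sqrt cc) dq.
have s0 : Num.sqrt (C * flat (c t) (c t)) != 0 by rewrite gt_eqF// sqrtr_gt0.
have dr : derivable (fun s => (Num.sqrt (C * flat (c s) (c s)))^-1) t 1.
  apply: derivableV => //; case: ds => H _; exact: H.
have dn := is_derive_scale (derivableP dr) hc.
eexists; split; first exact: dn.
- apply: (is_derive_flat_const (k := C^-1) _ dn).
  by apply: filterS near_sf => s /flat_space_form.
- exact: near_sf.
Qed.

End Normalization.

(** * Variation of a concircular field along a projected chord *)

Section Concircular.
Variables (R : realType) (n : nat) (C : R).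
Hypothesis C0 : C != 0.

Local Notation E := 'rV[R]_n.+1.
Local Notation flat := (@flat R n C).

Variables (V : E -> E) (mu : E -> R).
Hypothesis V_smooth : smooth_along (space_form C) V.
Hypothesis V_cov : forall p X, space_form C p -> tangent C p X ->
  is_cov_deriv C V p X (mu p *: X).

(** The velocity [X] of the projected curve is a combination of [c t] and [w], hence orthogonal to
    [Y]. The flat derivative of [V] along it is [mu X] plus a multiple of the base point, and both
    terms are orthogonal to [Y]. *)
Lemma derive_normal_component (c : R -> E) (t : R) (w Y : E) :
  is_derive t 1 c w -> space_form_cone C (c t) -> flat (c t) Y = 0 ->
  flat w Y = 0 -> is_derive t 1 (fun s => flat (V (normalize C (c s))) Y) 0.
Proof.
move=> hc ct cY wY.
have [a [hn tX near_sf]] := normalize_curve hc ct.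
set X := (_ + _) in hn tX.
have XY : flat X Y = 0 by rewrite /X !flatE cY wY !mulr0 addr0.
clearbody X; have pt := space_form_normalize ct.
have [G Gext] := V_smooth pt; case: (Gext) => [U [oU Up /(_ 1%N) /= [dG _] GV]].
have hG := is_derive_comp_curve (dG _ Up) hn.
have hGY := is_derive_flat C hG (is_derive_cst Y t 1).
apply: (near_eq_is_derive _ (is_derive_eq hGY _)).
- near=> s; congr (flat _ _); apply: GV; last by near: s.
  near: s; apply: (_ : {for t, continuous (normalize C \o c)}).
    by apply/differentiable_continuous/derivable1_diffP; case: hn.
  exact: open_nbhs_nbhs.
- have := V_cov pt tX Gext; rewrite /tan_proj => /eqP; rewrite subr_eq => /eqP ->.
  by rewrite !flatE XY cY !mulr0 !addr0.
Unshelve. all: by end_near. Qed.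

(** The radially projected chord plays the role of the geodesic from [p] to [q]; the sign condition
    keeps the chord inside the cone. By [flat_biorthogonal] it is enough to test [V p - V q] on
    vectors orthogonal to [p] and [q]. *)
Lemma concircular_sub_span p q : space_form C p -> space_form C q ->
  0 < C * flat p q -> exists a b, V p - V q = a *: p + b *: q.
Proof.
move=> Sp Sq pq; apply: (@flat_biorthogonal _ _ C) => Y pY qY.
pose c (s : R) := p + s *: (q - p).
have hc (t : R) : is_derive t 1 c (q - p) by exact: is_derive_line.
pose f s := flat (V (normalize C (c s))) Y.
have hf (t : R) : t \in `[0, 1] -> is_derive t 1 f 0.
  rewrite in_itv/= => /andP[t0 t1]; apply: (derive_normal_component (hc t)).
  - have cE : c t = (1 - t) *: p + t *: q.
      by rewrite /c scalerBr scalerBl scale1r addrCA addrC.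
    split.
    + rewrite cE !flatE (flatC _ q p) !flat_space_form//.
      set k := flat p q in pq *.
      rewrite [ltRHS](_ : _ = (1 - t) ^+ 2 + t ^+ 2 + 2 * (t * (1 - t) * (C * k)));
        last by field.
      have : 0 <= t * (1 - t) * (C * k).
        by apply: mulr_ge0; [rewrite mulr_ge0// subr_ge0|exact: ltW].
      (* Since [(1 - t)^2 + t^2 = 2 (t - 1/2)^2 + 1/2], the sum is positive. *)
      by have := sqr_ge0 (t - 2^-1); rewrite !expr2; lra.
    + move=> Cneg; rewrite cE !mxE.
      have [-> |tn0] := eqVneq t 0; first by rewrite mul0r addr0 subr0 mul1r Sp.2.
      apply: ltr_wpDl; first by rewrite mulr_ge0 ?subr_ge0// ltW// Sp.2.
      by apply: mulr_gt0; [rewrite lt0r tn0|exact: Sq.2].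
  - by rewrite /c !flatE pY qY; ring.
  - by rewrite !flatE pY qY; ring.
have : f 1 - f 0 = 0.
  have cf : {within `[0, 1], continuous f}.
    by apply: derivable_within_continuous => x /hf [].
  have df (x : R) : x \in `]0, 1[ -> is_derive x 1 f 0.
    by move=> /subset_itv_oo_cc; exact: hf.
  by case: (MVT_segment ler01 df cf) => x _ ->; rewrite mul0r.
rewrite /f /c scale0r scale1r addr0 [p + _]addrC subrK !normalize_space_form//.
by rewrite !flatE => /eqP; rewrite subr_eq0 => /eqP ->; rewrite subrr.
Qed.

End Concircular.

(** * Linear independence of three vectors *)

Definition independent3 (R : realType) (n : nat) (p q r : 'rV[R]_n) : Prop :=
  forall a b c : R, a *: p + b *: q + c *: r = 0 -> [/\ a = 0, b = 0 & c = 0].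

(** As [p] and [q] are independent, a nontrivial relation among [p], [q], [s] has a nonzero
    coefficient at [s], by which it can be divided. *)
Lemma dependent3_span (R : realType) (n : nat) (p q r s : 'rV[R]_n) :
  independent3 p q r -> ~ independent3 p q s -> exists a b, s = a *: p + b *: q.
Proof.
move=> pqr pqs; apply: contrapT => nspan; apply: pqs => a b c abc.
have [c0|c0] := eqVneq c 0.
  have [|-> -> _] := pqr a b 0; first by rewrite -abc c0 !scale0r.
  by rewrite c0.
case: nspan; exists (- (c^-1 * a)), (- (c^-1 * b)).
apply: (scalerI c0); rewrite scalerDr !scalerA !mulrN !mulVKf// !scaleNr -opprD.
by apply/eqP; rewrite -addr_eq0 addrC abc.
Qed.

Lemma exists_independent3 (R : realType) (n : nat) (p : 'rV[R]_n.+1) :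
  (2 <= n)%N -> p != 0 -> exists q r, independent3 p q r.
Proof.
case: n p => [|[|n]]// p _ /rV0Pn[j pj].
(* Two basis vectors away from an index [j] with [p 0 j != 0]: coordinate [j] isolates the
   coefficient of [p]. The indices [ord0] and [ord_max] differ because [n] is at least 2. *)
exists (delta_mx 0 (lift j ord0)), (delta_mx 0 (lift j ord_max)) => a b c abc.
have coord i : (a *: p + b *: delta_mx 0 (lift j ord0) +
                c *: delta_mx 0 (lift j ord_max)) 0 i = 0 by rewrite abc mxE.
have a0 : a = 0.
  move: (coord j); rewrite !mxE !eqxx !(negPf (neq_lift _ _)) !mulr0 !addr0.
  by move/eqP; rewrite mulf_eq0 (negPf pj) orbF => /eqP.
split=> //.
  move: (coord (lift j ord0)); rewrite a0 !mxE !eqxx (inj_eq lift_inj).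
  by rewrite mul0r add0r mulr1 mulr0 addr0.
move: (coord (lift j ord_max)); rewrite a0 !mxE !eqxx (inj_eq lift_inj).
by rewrite mul0r add0r mulr1 mulr0 add0r.
Qed.

(** * Local description of a concircular field by a constant vector *)

Section LocalForm.
Variables (R : realType) (n : nat) (C : R).
Hypothesis C0 : C != 0.

Local Notation E := 'rV[R]_n.+1.
Local Notation flat := (@flat R n C).

Lemma space_form_neq0 (p : E) : space_form C p -> p != 0.
Proof.
move=> /flat_space_form pp; apply/eqP => p0; move: pp.
by rewrite p0 flat0l => /esym/eqP; rewrite invr_eq0 (negPf C0).
Qed.

(** For small nonzero [t] the radial projection of [p + t w] is still close to [p]. As [k] and [t]
    are nonzero, independence of directions from [p] passes to the points obtained. *)
Lemma space_form_perturb (p w : E) (P : set E) :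
  space_form C p -> (\forall q \near p, P q) ->
  exists k t, [/\ k != 0, t != 0, P (k *: (p + t *: w)) &
    space_form C (k *: (p + t *: w))].
Proof.
move=> Sp Pp; pose c (t : R) := p + t *: w.
have c0 : c 0 = p by rewrite /c scale0r addr0.
have hc : is_derive (0 : R) 1 c w by exact: is_derive_line.
have := @normalize_curve _ _ C c 0 w hc; rewrite c0.
case=> [|a [hn _ near_sf]]; first exact: space_form_subcone.
have near_P : \forall t \near (0 : R), P (normalize C (c t)).
  apply: (_ : {for 0, continuous (normalize C \o c)}); last first.
    by rewrite /= c0 normalize_space_form.
  by apply/differentiable_continuous/derivable1_diffP; case: hn.
have : \forall t \near (0 : R)^', [/\ t != 0, P (normalize C (c t)) &
    space_form C (normalize C (c t))].
  near=> t; split; first by near: t; exact: nbhs_dnbhs_neq.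
    by near: t; exact: nbhs_dnbhs.
  by near: t; exact: nbhs_dnbhs.
case/filter_ex => t [t0 Pt St].
exists (Num.sqrt (C * flat (c t) (c t)))^-1, t; split=> //.
by apply: contraTneq (space_form_neq0 St) => k0; rewrite /normalize k0 scale0r eqxx.
Unshelve. all: by end_near. Qed.

(** By continuity, since [C * flat p p = 1]. It makes the span relation available for every pair of
    points of [B] in the space form. *)
Lemma flat_pos_nbhs (p : E) : space_form C p ->
  exists2 B : set E, nbhs p B & forall q r, B q -> B r -> 0 < C * flat q r.
Proof.
move=> Sp.
have H : C * flat x.1 x.2 @[x --> (p, p)] --> C * flat p p.
  by apply: cvgM; [exact: cvg_cst|apply: cvg_flat; [exact: cvg_fst|exact: cvg_snd]].
have [|[A B] /= [Ap Bp] AB] := cvgr_gt _ H 0.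
  by rewrite flat_space_form// divff.
exists (A `&` B); first exact: filterI.
by move=> q r [Aq _] [_ Br]; exact: (AB (q, r)).
Qed.

Variable V : E -> E.
Hypothesis V_tangent : forall p, space_form C p -> tangent C p (V p).
Hypothesis V_span : forall p q, space_form C p -> space_form C q ->
  0 < C * flat p q -> exists a b, V p - V q = a *: p + b *: q.

(** The differences of [V] around the triangle [p], [q], [r] add up to zero, and in that relation
    the coefficient of [p] is [a - a']. *)
Lemma span_coefficient_unique (p q r : E) (a b a' b' : R) :
  space_form C q -> space_form C r -> 0 < C * flat q r -> independent3 p q r ->
  V p - V q = a *: p + b *: q -> V p - V r = a' *: p + b' *: r -> a = a'.
Proof.
move=> Sq Sr qr pqr pq pr; have [g [d qrE]] := V_span Sq Sr qr.
have [] := pqr (a - a') (b + g) (d - b'); last by move/eqP; rewrite subr_eq0 => /eqP.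
have : V p - V q + (V q - V r) - (V p - V r) = 0.
  by rewrite addrA subrK subrr.
rewrite pq pr qrE => <-; apply/rowP => i; rewrite !mxE; ring.
Qed.

Lemma local_concircular_form (p : E) : (2 <= n)%N -> space_form C p ->
  exists a, \forall q \near p, space_form C q -> V q = tan_proj C q a.
Proof.
move=> n2 Sp; have [B Bp Bpos] := flat_pos_nbhs Sp.
have [w1 [w2 pw]] := exists_independent3 n2 (space_form_neq0 Sp).
have [k1 [t1 [k10 t10]]] := @space_form_perturb p w1 B Sp Bp.
set p1 := k1 *: _ => B1 S1.
have [k2 [t2 [k20 t20]]] := @space_form_perturb p w2 B Sp Bp.
set p2 := k2 *: _ => B2 S2.
have B0 := nbhs_singleton Bp.
have p012 : independent3 p p1 p2.
  move=> a b c abc; have [|h1 h2 h3] := pw (a + b * k1 + c * k2) (b * k1 * t1) (c * k2 * t2).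
    by rewrite -abc /p1 /p2; apply/rowP => i; rewrite !mxE; ring.
  have b0 : b = 0 by apply/eqP; move/eqP: h2; rewrite !mulf_eq0 (negPf k10) (negPf t10) !orbF.
  have c0 : c = 0 by apply/eqP; move/eqP: h3; rewrite !mulf_eq0 (negPf k20) (negPf t20) !orbF.
  by split=> //; move: h1; rewrite b0 c0 !mul0r !addr0.
have p021 : independent3 p p2 p1.
  by move=> a b c abc; case: (p012 a c b); rewrite // addrAC.
have [a1 [b1 Vp1]] := V_span Sp S1 (Bpos _ _ B0 B1).
have [a2 [b2 Vp2]] := V_span Sp S2 (Bpos _ _ B0 B2).
have a12 := span_coefficient_unique S1 S2 (Bpos _ _ B1 B2) p012 Vp1 Vp2.
(* The coefficient of [p] is the same for [p1] and [p2]; removing that multiple of [p] from [V p]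
   gives the candidate constant vector. *)
pose a := V p - a1 *: p.
have Vq q : B q -> space_form C q -> exists b, V q = a + b *: q.
  move=> Bq Sq; have [al [be Vpq]] := V_span Sp Sq (Bpos _ _ B0 Bq).
  have aE : al = a1 -> exists b, V q = a + b *: q.
    move=> alE; exists (- be); rewrite /a -alE scaleNr -addrA -opprD -Vpq.
    by rewrite opprB addrC subrK.
  (* Off the plane of [p] and [p1], comparison with [p1] determines the coefficient; off the plane
     of [p] and [p2], comparison with [p2] does. A point in both planes is a multiple of [p]. *)
  have [i1|/(dependent3_span p012)[c [d qE]]] := pselect (independent3 p p1 q).
    by apply/aE/esym; exact: (span_coefficient_unique S1 Sq (Bpos _ _ B1 Bq) i1 Vp1 Vpq).
  have [i2|/(dependent3_span p021)[c' [d' qE']]] := pselect (independent3 p p2 q).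
    apply/aE/esym; rewrite a12.
    exact: (span_coefficient_unique S2 Sq (Bpos _ _ B2 Bq) i2 Vp2 Vpq).
  have [|_ d0 _] := p012 (c - c') d (- d').
    by rewrite -(subrr q) {1}qE qE'; apply/rowP => i; rewrite !mxE; ring.
  have {}qE : q = c *: p by rewrite qE d0 scale0r addr0.
  (* Both points lie in the space form, so [c^2 = 1]; positivity of [C * flat p q] excludes
     [c = -1]. *)
  have c1 : c = 1.
    have := flat_space_form Sq; rewrite qE !flatE flat_space_form// => cc.
    have := Bpos _ _ B0 Bq; rewrite qE !flatE flat_space_form// => c_gt0.
    rewrite mulrCA divff// mulr1 in c_gt0.
    have /eqP : (c - 1) * (c + 1) = 0.
      apply: (mulIf (invr_neq0 C0)).
      have -> : (c - 1) * (c + 1) / C = c * (c / C) - C^-1 by field.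
      by rewrite cc subrr mul0r.
    by rewrite mulf_eq0 subr_eq0 addr_eq0 => /orP[/eqP//|/eqP cN]; lra.
  by exists a1; rewrite qE c1 scale1r /a subrK.
clearbody a; exists a; apply: filterS Bp => q /Vq H Sq; have [b Vqb] := H Sq.
have := V_tangent Sq; rewrite /tangent Vqb !flatE flat_space_form// => ab.
rewrite /tan_proj -scaleNr; congr (_ + _ *: _).
by rewrite (_ : flat a q = - (b / C)); [field|apply/eqP; rewrite -addr_eq0; exact/eqP].
Qed.

End LocalForm.

(** * Tools for smoothness and differentiability *)

Section Smoothness.
Variable R : realType.

Lemma smooth_on_cst (V W : normedModType R) (U : set V) (a : W) :
  smooth_on U (fun=> a).
Proof.
move=> k; elim: k a => [|k IH] a /=; first by move=> u _; exact: cst_continuous.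
split=> [u _|v]; first exact: differentiable_cst.
rewrite [X in Ck _ _ X](_ : _ = fun=> 0); first exact: IH.
by apply/funext => u; exact: derive_cst.
Qed.

(** Reduces smoothness of a polynomial map to differentiating until the derivative is constant. *)
Lemma smooth_on_derive (V W : normedModType R) (U : set V) (F : V -> W) :
  (forall u, differentiable F u) ->
  (forall v, smooth_on U (fun u => 'D_v F u)) -> smooth_on U F.
Proof.
move=> dF sF [|k] /=; first by move=> u _; exact: differentiable_continuous.
by split=> // v; exact: sF.
Qed.

Lemma differentiable_rV (V : normedModType R) (n : nat) (f : V -> 'rV[R]_n)
    (u : V) :
  (forall j, differentiable (fun w => f w 0 j) u) -> differentiable f u.
Proof.
move=> df.
rewrite (_ : f = \sum_(j < n) (fun w => f w 0 j *: delta_mx 0 j)).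
  by apply: differentiable_sum => j; exact: differentiableZl.
by apply/funext => w; rewrite fct_sumE; exact: row_sum_delta.
Qed.

Lemma differentiable_flat (n : nat) (C : R) (a p : 'rV[R]_n.+1) :
  differentiable (flat C a) p.
Proof.
have coord i : differentiable (fun q : 'rV[R]_n.+1 => a 0 i * q 0 i) p.
  exact: (differentiableM (differentiable_cst (a 0 i) p) (differentiable_coord _ _ _)).
have sum := differentiable_sum (fun i => coord (lift 0 i)).
have := differentiableD (differentiableZ (eps C) (coord 0)) sum.
congr (differentiable _ _); apply/funext => q.
by rewrite /flat fctE [LHS]/= fct_sumE.
Qed.

End Smoothness.

(** * Tangential projections of constant vectors are concircular *)

Section Projection.
Variables (R : realType) (n : nat) (C : R).
Hypothesis C0 : C != 0.

Local Notation E := 'rV[R]_n.+1.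
Local Notation flat := (@flat R n C).
Local Notation tan_proj := (@tan_proj R n C).
Implicit Types a p X : E.

Lemma tan_projE p X : flat X p = 0 -> tan_proj p X = X.
Proof. by rewrite /tan_proj => ->; rewrite mulr0 scale0r subr0. Qed.

Lemma is_derive_tan_proj (V : normedModType R) (f : V -> E) (u v : V) a df :
  is_derive u v f df ->
  is_derive u v (fun w => tan_proj (f w) a)
    (- ((C * flat a df) *: f u + (C * flat a (f u)) *: df)).
Proof.
move=> hf.
have hs := is_deriveZ C (is_derive_flat C (is_derive_cst a u v) hf).
have h := is_deriveB (is_derive_cst a u v) (is_derive_scale hs hf).
apply: (is_derive_eq h); by rewrite sub0r flat0l add0r.
Qed.

Lemma smooth_on_flat (U : set E) a k : smooth_on U (fun p => k * flat a p : R^o).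
Proof.
apply: smooth_on_derive => [p|v].
  exact: (differentiableZ _ (differentiable_flat C a p)).
rewrite [X in smooth_on _ X](_ : _ = fun=> k * flat a v); first exact: smooth_on_cst.
apply/funext => p.
have [_ ->] := is_deriveZ k (is_derive_flat C (is_derive_cst a p v) (is_derive_id p v)).
by rewrite flat0l add0r.
Qed.

Lemma smooth_on_tan_proj (U : set E) a : smooth_on U (fun p => tan_proj p a).
Proof.
apply: smooth_on_derive => [p|v].
  apply: differentiable_rV => j.
  have dM := differentiableM (differentiableZ C (differentiable_flat C a p))
    (differentiable_coord p 0 j).
  have := differentiableB (differentiable_cst (a 0 j) p) dM.
  by congr (differentiable _ _); apply/funext => w; rewrite /tan_proj !mxE.
rewrite [X in smooth_on _ X](_ : _ =
    fun p => - ((C * flat a v) *: p + (C * flat a p) *: v)); last first.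
  by apply/funext => p; case: (is_derive_tan_proj a (is_derive_id p v)).
(* The projection is quadratic in [p], so its derivative is linear and a second differentiation
   leaves a constant. *)
apply: smooth_on_derive => [p|w].
  apply: differentiableN; apply: differentiableD; first exact: differentiableZ.
  by apply: differentiableZl; apply: differentiableZ; exact: differentiable_flat.
rewrite [X in smooth_on _ X](_ : _ =
    fun=> - ((C * flat a v) *: w + (C * flat a w) *: v)); first exact: smooth_on_cst.
apply/funext => p.
have hs := is_deriveZ C (is_derive_flat C (is_derive_cst a p w) (is_derive_id p w)).
have hd := is_deriveD (is_deriveZ (C * flat a v) (is_derive_id p w))
  (is_derive_scale hs (is_derive_cst v p w)).
have [_ ->] := is_deriveN hd.
by rewrite flat0l add0r scaler0 addr0.
Qed.

(* The projection to the space form of the line p + t X has velocity X at p. *)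
Lemma local_extension_derive (W : normedModType R) (F : E -> W) p X
    (G1 G2 : E -> W) :
  space_form C p -> tangent C p X ->
  local_extension (space_form C) F p G1 ->
  local_extension (space_form C) F p G2 -> 'D_X G1 p = 'D_X G2 p.
Proof.
move=> Sp pX [U1 [oU1 U1p /(_ 1%N) /= [dG1 _] G1F]]
  [U2 [oU2 U2p /(_ 1%N) /= [dG2 _] G2F]].
pose c (t : R) := p + t *: X.
have c0 : c 0 = p by rewrite /c scale0r addr0.
have := @normalize_curve _ _ C c 0 X (is_derive_line p X 0).
rewrite c0 flat_space_form// divff// sqrtr1 invr1 scale1r normalize_space_form//.
case=> [|b [hn tX near_sf]]; first exact: space_form_subcone.
(* Pairing the tangent velocity [b p + X] with [p] leaves [b / C]. *)
have b0 : b = 0.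
  move: tX; rewrite /tangent !flatE pX addr0 flat_space_form// => /eqP.
  by rewrite mulf_eq0 invr_eq0 (negPf C0) orbF => /eqP.
rewrite b0 scale0r add0r in hn.
set g := _ \o c in hn.
have g0 : g 0 = p by rewrite /g /= c0 normalize_space_form.
have gc : {for 0, continuous g}.
  by apply/differentiable_continuous/derivable1_diffP; case: hn.
have dG1' : differentiable G1 (g 0) by rewrite g0; exact: dG1.
have dG2' : differentiable G2 (g 0) by rewrite g0; exact: dG2.
have [_ d1] := is_derive_comp_curve dG1' hn.
have [_ d2] := is_derive_comp_curve dG2' hn.
rewrite g0 in d1 d2; rewrite -d1 -d2; apply: near_eq_derive.
near=> t; rewrite /= [RHS]G2F ?[LHS]G1F//; near: t => //.
- by apply: gc; rewrite g0; exact: open_nbhs_nbhs.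
- by apply: gc; rewrite g0; exact: open_nbhs_nbhs.
Unshelve. all: by end_near. Qed.

(** The product rule gives a multiple of [p], removed by the projection, and [- C <a, p> X], which
    is already tangent. *)
Lemma tan_proj_derive a p X : space_form C p -> tangent C p X ->
  tan_proj p ('D_X (fun p => tan_proj p a) p) = (- (C * flat a p)) *: X.
Proof.
move=> Sp pX; have [_ ->] := is_derive_tan_proj a (is_derive_id p X).
rewrite /tan_proj !flatE /= pX flat_space_form//.
rewrite [X in _ - X *: _](_ : _ = - (C * flat a X)); last by field.
by rewrite opprD scaleNr opprK addrAC addNr add0r scaleNr.
Qed.

Lemma local_extension_self (W : normedModType R) (S : set E) (F : E -> W) p :
  smooth_on setT F -> local_extension S F p F.
Proof. by exists setT; split=> //; exact: openT. Qed.

(** The map is smooth on the whole space, hence a local extension of itself; by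
    [local_extension_derive] every other extension has the same tangential derivatives. *)
Lemma concircular_tan_proj a : concircular C (fun p => tan_proj p a).
Proof.
have ext p := local_extension_self (space_form C) p (smooth_on_tan_proj setT a).
split; first split=> [p Sp|p Sp].
- by exists (fun p => tan_proj p a); exact: ext.
- by rewrite /tangent !flatE flat_space_form//; field.
exists (fun p => - C * flat a p); split=> [p Sp|p X Sp pX G extG].
  exists (fun p => - C * flat a p).
  exact/local_extension_self/smooth_on_flat.
by rewrite (local_extension_derive Sp pX extG (ext p)) tan_proj_derive// mulNr.
Qed.

End Projection.

(** * From vanishing derivatives to constancy *)

Section LocallyConstant.
Variable R : realType.

Lemma is_derive_along_line (V W : normedModType R) (f : V -> W) (u v : V)
    (t : R) (df : W) :
  is_derive (u + t *: v) v f df -> is_derive t 1 (fun s : R => f (u + s *: v)) df.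
Proof.
move=> [fd fE].
have quotE : (fun h : R => h^-1 *: (((fun s : R => f (u + s *: v)) \o shift t) (h *: 1)
      - f (u + t *: v))) =
    (fun h : R => h^-1 *: ((f \o shift (u + t *: v)) (h *: v) - f (u + t *: v))).
  apply/funext => h /=; congr (_ *: (f _ - _)).
  by rewrite [h *: _]mulr1 scalerDl addrCA.
by apply: DeriveDef; rewrite /derivable /derive quotE.
Qed.

(** The segment from the centre to [w] stays in the ball, so the mean value theorem applies along
    it. *)
Lemma is_derive_ball_const (V : normedModType R) (f : V -> R) (u : V) (e : R) :
  (forall w v, ball u e w -> is_derive w v f 0) ->
  forall w, ball u e w -> f w = f u.
Proof.
move=> df w uw; pose d := w - u; pose h (t : R) := f (u + t *: d).
have hd (t : R) : t \in `[0, 1] -> is_derive t 1 h 0.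
  rewrite in_itv/= => /andP[t0 t1]; apply/is_derive_along_line/df.
  move: uw; rewrite -ball_normE /= opprD addNKr normrN distrC -/d.
  by apply: le_lt_trans; rewrite normrZ ger0_norm// ler_piMl.
have ch : {within `[0, 1], continuous h}.
  by apply: derivable_within_continuous => x /hd [].
have dh (x : R) : x \in `]0, 1[ -> is_derive x 1 h 0.
  by move=> /subset_itv_oo_cc; exact: hd.
have [x _] := MVT_segment ler01 dh ch.
rewrite mul0r => /eqP; rewrite subr_eq0 => /eqP.
by rewrite /h scale0r addr0 scale1r /d [u + _]addrC subrK.
Qed.

Lemma connected_locally_const (T : topologicalType) (A : Type) (f : T -> A) :
  connected [set: T] -> (forall s, \forall t \near s, f t = f s) ->
  forall s t, f s = f t.
Proof.
move=> cT lf s t.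
suff : [set t | f t = f s] = setT by move/seteqP => [_ /(_ t I)] ->.
(* With no topology on [A], local constancy makes every preimage open, hence each level set is also
   closed. *)
have op (P : set A) : open (f @^-1` P).
  by rewrite openE => r Pr; apply: filterS (lf r) => q /= ->.
apply: cT; first by exists s.
  by exists [set t | f t = f s]; [exact: (op [set f s])|rewrite setTI].
exists [set t | f t = f s]; last by rewrite setTI.
by rewrite -openC; exact: (op (~` [set f s])).
Qed.

End LocallyConstant.

(** * Geometry of a connected hypersurface *)

Section Hypersurface.
Variables (R : realType) (n : nat) (C : R).
Variables (M : topologicalType) (x : M -> 'rV[R]_n.+1) (N : M -> 'rV[R]_n.+1).
Hypothesis C0 : C != 0.
Hypothesis hM : hypersurface C x.
Hypothesis hconn : connected [set: M].

Local Notation E := 'rV[R]_n.+1.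
Local Notation flat := (@flat R n C).
Local Notation tan_proj := (@tan_proj R n C).

(** A parametrization sends open subsets of [U] to open sets, so it carries neighbourhoods of [u] to
    neighbourhoods of [phi u]. *)
Lemma hypersurface_near (P : M -> Prop) (U : set 'rV[R]_n.-1)
    (phi : 'rV[R]_n.-1 -> M) u :
  local_param x U phi -> U u -> (\forall w \near u, P (phi w)) ->
  \forall t \near phi u, P t.
Proof.
move=> [oU _ op _ _] Uu Pu.
have nU : nbhs u ([set w | P (phi w)] `&` U).
  by apply: filterI => //; exact: open_nbhs_nbhs.
pose O := interior ([set w | P (phi w)] `&` U).
have OU : O `<=` U by move=> w /interior_subset [].
have Ou : (phi @` O) (phi u) by exists u.
apply: filterS (open_nbhs_nbhs (conj (op _ (@open_interior _ _) OU) Ou)).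
by move=> _ [w /interior_subset[Pw _] <-].
Qed.

Lemma hypersurface_const (f : M -> R) :
  (forall U phi, local_param x U phi -> forall u v, U u ->
    is_derive u v (f \o phi) 0) -> forall s t, f s = f t.
Proof.
move=> df; apply: connected_locally_const hconn _ => s.
have [_ _ _ /(_ s)[U [phi [hphi [u Uu <-]]]]] := hM.
apply: (hypersurface_near (U := U)) => //; have [oU _ _ _ _] := hphi.
have /nbhs_ballP[e e0 eU] : nbhs u U by exact: open_nbhs_nbhs.
apply/nbhs_ballP; exists e => //= w uw.
apply: (is_derive_ball_const (f := f \o phi) (e := e)) => // w' v /eU Uw'.
exact: (df _ _ hphi _ _ Uw').
Qed.

Section LocalParam.
Variables (U : set 'rV[R]_n.-1) (phi : 'rV[R]_n.-1 -> M).
Hypothesis hphi : local_param x U phi.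
Variables (u v : 'rV[R]_n.-1).
Hypothesis Uu : U u.

Lemma near_local_param : \forall w \near u, U w.
Proof. by case: hphi => oU _ _ _ _; exact: open_nbhs_nbhs. Qed.

Lemma is_derive_immersion : is_derive u v (x \o phi) ('D_v (x \o phi) u).
Proof.
by case: hphi => _ _ _ /(_ 1%N)[/(_ u Uu) dx _] _; exact: differentiable_is_derive.
Qed.

Lemma tangent_immersion : tangent C (x (phi u)) ('D_v (x \o phi) u).
Proof.
apply: (is_derive_flat_const (k := C^-1) _ is_derive_immersion).
by near=> w; case: hM => _ _ /(_ (phi w)) /flat_space_form.
Unshelve. all: by end_near. Qed.

Hypothesis hN : unit_normal C x N.

Lemma flat_normal_immersion : flat (N (phi u)) ('D_v (x \o phi) u) = 0.
Proof. by case: hN => _ _ _ /(_ _ _ hphi u v Uu). Qed.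

Lemma is_derive_normal : is_derive u v (N \o phi) ('D_v (N \o phi) u).
Proof.
by case: hN => /(_ _ _ hphi 1%N)[/(_ u Uu) dN _] _ _ _; exact: differentiable_is_derive.
Qed.

Lemma flat_derive_normal : flat ('D_v (N \o phi) u) (N (phi u)) = 0.
Proof.
apply: (is_derive_flat_const (k := 1) _ is_derive_normal).
by near=> w; case: hN => _ _ /(_ (phi w)).
Unshelve. all: by end_near. Qed.

(** Differentiating [<N, x> = 0] gives [<dN, x> + <N, dx> = 0], and the second term vanishes by
    normality. *)
Lemma tangent_derive_normal : tangent C (x (phi u)) ('D_v (N \o phi) u).
Proof.
have [_] := is_derive_flat C is_derive_normal is_derive_immersion.
rewrite (near_eq_derive (g := cst 0)); last first.
  by near=> w; case: hN => _ /(_ (phi w)).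
by rewrite derive_cst flat_normal_immersion addr0.
Unshelve. all: by end_near. Qed.

Lemma shape_opE : shape_op C x N phi u v = - 'D_v (N \o phi) u.
Proof. by rewrite /shape_op tan_projE// tangent_derive_normal. Qed.

End LocalParam.

Lemma umbilical_normal_tan_proj : unit_normal C x N -> totally_umbilical C x N ->
  exists a, forall s, tan_proj (x s) a = N s.
Proof.
move=> hN [m hm].
have [a aE] : exists a, forall s, N s + m *: x s = a.
  (* Connectedness does not exclude an empty [M]. *)
  have [[s0 _]|Mempty] := pselect (exists s : M, True); last first.
    by exists 0 => s; case: Mempty; exists s.
  exists (N s0 + m *: x s0) => s; apply/rowP => j.
  apply: (hypersurface_const (f := fun s => (N s + m *: x s) 0 j)) => U phi hphi u v Uu.
  have := hm U phi hphi u v Uu; rewrite (shape_opE hphi v Uu hN).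
  move=> /(congr1 -%R); rewrite opprK => dN.
  have := is_deriveD (is_derive_normal hphi v Uu hN)
    (is_deriveZ m (is_derive_immersion hphi v Uu)).
  by rewrite dN addNr => /is_derive_mxP /(_ 0 j); rewrite mxE.
exists a => s; have [_ _ /(_ s) Ss _] := hM; have [_ /(_ s) Ns _ _] := hN.
(* Here [C <a, x> = m], so the projection removes exactly the term [m x]. *)
rewrite -(aE s) /tan_proj !flatE Ns flat_space_form// add0r mulrCA divff// mulr1.
by rewrite addrK.
Qed.

Lemma umbilical_of_concircular (V : E -> E) (lambda : M -> R^o) :
  (2 <= n)%N -> unit_normal C x N -> concircular C V ->
  smooth_on_hypersurface x lambda -> (forall s, lambda s != 0) ->
  (forall s, V (x s) = lambda s *: N s) -> totally_umbilical C x N.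
Proof.
move=> n2 hN [[V_smooth V_tangent] [mu [_ V_cov]]] slambda lambda0 Vx.
have S s : space_form C (x s) by case: hM.
have V_span p q := @concircular_sub_span _ _ _ C0 V mu V_smooth V_cov p q.
have local_form U phi u : local_param x U phi -> U u -> exists a, \forall w \near u,
    V (x (phi w)) = tan_proj (x (phi w)) a /\ mu (x (phi w)) = - (C * flat a (x (phi w))).
  move=> hphi Uu.
  have [a Va] := local_concircular_form C0 V_tangent V_span n2 (S (phi u)).
  exists a.
  (* The formula must hold on a neighbourhood of each nearby point, not only at the point, for the
     projection of [a] to be a local extension of [V] there. *)
  have Va' := nbhs_interior Va.
  have [_ _ _ sx immx] := hphi.
  have cx : {for u, continuous (x \o phi)} by exact: (sx 0%N u Uu).
  have near_a : \forall w \near u, nbhs (x (phi w)) [set q | space_form C q -> V q = tan_proj q a].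
    exact: (cx _ Va').
  near=> w.
  have Uw : U w by near: w; exact: (near_local_param hphi Uu).
  have nw : nbhs (x (phi w)) [set q | space_form C q -> V q = tan_proj q a] by near: w.
  split; first exact: (nbhs_singleton nw).
  (* As [n] is at least 2, the hypersurface has a nonzero tangent vector [X]; comparing the two
     multiples of [X] then determines [mu]. *)
  have [v v0] : exists v : 'rV[R]_n.-1, v != 0.
    case: n n2 => [|[|n']]// _; exists (const_mx 1).
    by apply/rV0Pn; exists ord0; rewrite mxE oner_neq0.
  pose X := 'D_v (x \o phi) w.
  have X0 : X != 0 by apply: contraNneq v0 => /(immx _ _ Uw)->.
  have tX : tangent C (x (phi w)) X := tangent_immersion hphi v Uw.
  have ext : local_extension (space_form C) V (x (phi w)) (fun q => tan_proj q a).
    exists (interior [set q | space_form C q -> V q = tan_proj q a]); split.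
    - exact: open_interior.
    - exact: nw.
    - exact: smooth_on_tan_proj.
    - by move=> q /interior_subset Vq Sq; rewrite -Vq.
  have := V_cov _ X (S _) tX _ ext; rewrite tan_proj_derive// => /eqP.
  by rewrite -subr_eq0 -scalerBl scaler_eq0 (negPf X0) orbF subr_eq0 => /eqP.
have dlambda U phi (hphi : local_param x U phi) u v (Uu : U u) :
    [/\ is_derive u v (lambda \o phi) 0, is_derive u v (mu \o x \o phi) 0 &
      lambda (phi u) *: 'D_v (N \o phi) u = mu (x (phi u)) *: 'D_v (x \o phi) u].
  have [a near_a] := local_form U phi u hphi Uu.
  have [Va mua] := nbhs_singleton near_a.
  have hx := is_derive_immersion hphi v Uu.
  have tX := tangent_immersion hphi v Uu; rewrite /tangent in tX.
  have NX := flat_normal_immersion hphi v Uu hN.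
  set X := 'D_v (x \o phi) u in hx tX NX *.
  (* Pair both expressions of [V] with [X]: both [N] and [x] are orthogonal to [X], which leaves
     [<a, X>]. *)
  have aX : flat a X = 0.
    have := congr1 (fun Y => flat Y X) (Vx (phi u)).
    rewrite Va /tan_proj !flatE NX (flatC _ (x _) X) tX.
    by rewrite !mulr0 oppr0 addr0.
  have hmu : is_derive u v (mu \o x \o phi) 0.
    apply: (near_eq_is_derive (f := fun w => (- C) * flat a (x (phi w)))).
      by near=> w; rewrite /= (near near_a w _).2// mulNr.
    have := is_deriveZ (- C) (is_derive_flat C (is_derive_cst a u v) hx).
    by rewrite flat0l add0r aX scaler0.
  have hl : is_derive u v (lambda \o phi) ('D_v (lambda \o phi) u).
    by case: (slambda _ _ hphi 1%N) => /(_ u Uu) + _; exact: differentiable_is_derive.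
  have hlN := is_derive_scale hl (is_derive_normal hphi v Uu hN).
  have hV := is_derive_tan_proj C a hx.
  (* The derivative of [V] along the immersion is computed twice, from [lambda N] and from the
     projection of [a]. *)
  have dE : 'D_v (lambda \o phi) u *: N (phi u) + lambda (phi u) *: 'D_v (N \o phi) u =
      mu (x (phi u)) *: X.
    transitivity ('D_v (fun w => tan_proj (x (phi w)) a) u).
      case: hlN => _ <-; apply: near_eq_derive.
      by near=> w; rewrite -(near near_a w _).1//= -Vx.
    by case: hV => _ ->; rewrite aX mulr0 scale0r add0r mua scaleNr.
  (* Pairing with the unit vector [N] isolates this derivative, because [dN] and [X] are orthogonal
     to [N]. *)
  have dl0 : 'D_v (lambda \o phi) u = 0.
    have := congr1 (fun Y => flat Y (N (phi u))) dE; rewrite !flatE.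
    rewrite (flat_derive_normal hphi v Uu hN) (flatC _ X) NX !mulr0 addr0.
    by case: hN => _ _ -> _; rewrite mulr1.
  by move: dE hl; rewrite dl0 scale0r add0r.
have [[s0 _]|Mempty] := pselect (exists s : M, True); last first.
  by exists 0 => U phi _ u; case: Mempty; exists (phi u).
have lambdaE s : lambda s = lambda s0.
  apply: (hypersurface_const (f := lambda)) => U phi hphi u v Uu.
  by case: (dlambda U phi hphi u v Uu).
have muE s : mu (x s) = mu (x s0).
  apply: (hypersurface_const (f := mu \o x)) => U phi hphi u v Uu.
  by case: (dlambda U phi hphi u v Uu).
exists (- (mu (x s0) / lambda s0)) => U phi hphi u v Uu.
rewrite (shape_opE hphi v Uu hN); have [_ _] := dlambda U phi hphi u v Uu.
rewrite lambdaE muE => dN; rewrite scaleNr; congr (- _).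
by apply: (scalerI (lambda0 s0)); rewrite dN scalerA mulrCA divff ?mulr1.
Unshelve. all: by end_near. Qed.

End Hypersurface.

Theorem proposition4 (R : realType) (n : nat) (C : R)
    (M : topologicalType) (x : M -> 'rV[R]_n.+1) (N : M -> 'rV[R]_n.+1)
    (hn : (2 <= n)%N) (hC : C != 0)
    (hM : hypersurface C x) (hconn : connected [set: M])
    (hN : unit_normal C x N) :
  (exists V : 'rV[R]_n.+1 -> 'rV[R]_n.+1, concircular C V /\
     exists lambda : M -> R^o,
       [/\ smooth_on_hypersurface x lambda,
           forall s, lambda s != 0 &
           forall s, V (x s) = lambda s *: N s]) <->
  totally_umbilical C x N.
Proof.
split=> [[V [cV [lambda [sl l0 Vx]]]]|umb].
  exact: (umbilical_of_concircular hC hM hconn hn hN cV sl l0 Vx).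
have [a Na] := umbilical_normal_tan_proj hC hM hconn hN umb.
exists (fun p => tan_proj C p a); split; first exact: concircular_tan_proj.
(* The projection of [a] restricts to [N] itself, so the factor is 1. *)
exists (fun=> 1); split=> [U phi _|s|s]; last by rewrite scale1r.
  exact: smooth_on_cst.
exact: oner_neq0.
Qed.
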